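(* Let $h=h(t,x-\xi)=e^{-\frac{(x-\xi)^{2}}{4t}}$ for $t>0$ and $x,\xi\in\mathbb{R}$. Then the following identities hold: $$\frac{(h'_{x})^{3}}{h^{2}}=h'''_{xxx}+\frac{3}{2t}h'_{x},$$ $$\frac{(h'_{x})^{2}h'_{t}}{h^{2}}=h'''_{xxt}+\frac{2}{t}h''_{xx}+\frac{1}{2t}h'_{t}+\frac{1}{2t^{2}}h,$$ $$\frac{(h'_{t})^{3}}{h^{2}}=h'''_{ttt}+\frac{6}{t}h''_{tt}+\frac{6}{t^{2}}h'_{t},$$ $$\frac{(h'_{t})^{2}h'_{x}}{h^{2}}=h'''_{xtt}+\frac{4}{t}h''_{tx}+\frac{2}{t^{2}}h'_{x}.$$
   Context: Primes with subscripts denote partial derivatives with respect to the indicated variables $t$ and $x$, with $\xi$ fixed. *)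

(* Defs.v *)
From Stdlib Require Import Reals.
From Coquelicot Require Import Coquelicot.
Open Scope R_scope.

Definition h (t y : R) : R := exp (- (y ^ 2 / (4 * t))).

(* Partial derivatives of a function u of (t, x).  [Derive] is total; it is
   only evaluated at t > 0, where (t, x) |-> h t (x - xi) is smooth, so that
   its value is the genuine derivative. *)
Definition pd_t (u : R -> R -> R) : R -> R -> R :=
  fun t x => Derive (fun s => u s x) t.
Definition pd_x (u : R -> R -> R) : R -> R -> R :=
  fun t x => Derive (fun y => u t y) x.

(* Subscripts are read left to right as the order of differentiation. *)
Definition pd_xx u := pd_x (pd_x u).
Definition pd_tx u := pd_x (pd_t u).
Definition pd_tt u := pd_t (pd_t u).
Definition pd_xxx u := pd_x (pd_x (pd_x u)).
Definition pd_xxt u := pd_t (pd_x (pd_x u)).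
Definition pd_xtt u := pd_t (pd_t (pd_x u)).
Definition pd_ttt u := pd_t (pd_t (pd_t u)).

(* Main.v *)
(* Every derivative of [h] is a rational function of (t, x) times [h].  On such
   products d/dx acts on the rational factor P as P_x - (x - xi) / (2t) P, and
   d/dt as P_t + (x - xi)^2 / (4t^2) P, so each identity reduces to one between
   rational functions. *)
Require Import Defs.
From Stdlib Require Import Reals Lra.
From Coquelicot Require Import Coquelicot.
Open Scope R_scope.

Lemma h_neq_0 (t y : R) : h t y <> 0.
Proof. apply Rgt_not_eq, exp_pos. Qed.

Lemma is_derive_h_x (xi t x : R) (ht : 0 < t) :
  is_derive (fun y => h t (y - xi)) x (- (x - xi) / (2 * t) * h t (x - xi)).
Proof.
  unfold h; auto_derive; [lra|].
  (* The exponent left by [auto_derive] is only convertible to that of [h]; restoring [h] gives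
     [field] a single atom. *)
  match goal with |- _ * exp ?e = _ => change (exp e) with (h t (x - xi)) end.
  fold (h t (x - xi)); field; lra.
Qed.

Lemma is_derive_h_t (xi t x : R) (ht : 0 < t) :
  is_derive (fun s => h s (x - xi)) t
    ((x - xi) ^ 2 / (4 * t ^ 2) * h t (x - xi)).
Proof.
  unfold h; auto_derive; [lra|].
  match goal with |- _ * exp ?e = _ => change (exp e) with (h t (x - xi)) end.
  fold (h t (x - xi)); field; lra.
Qed.

(** The hypothesis on [u] has the shape of the conclusion with the point generalised over positive
    times, so the rule can be iterated when [u] is itself a partial derivative. *)
Lemma pd_x_mult_h (xi : R) (u P : R -> R -> R) (t x dP : R) (ht : 0 < t) :
  (forall s y, 0 < s -> u s y = P s y * h s (y - xi)) ->
  is_derive (fun y => P t y) x dP ->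
  pd_x u t x = (dP - (x - xi) / (2 * t) * P t x) * h t (x - xi).
Proof.
  intros Hu HP; unfold pd_x; apply is_derive_unique.
  apply (is_derive_ext (fun y => P t y * h t (y - xi))).
  { intros y; symmetry; now apply Hu. }
  replace (_ * h t (x - xi))
    with (dP * h t (x - xi) + P t x * (- (x - xi) / (2 * t) * h t (x - xi)))
    by (field; lra).
  apply (is_derive_mult (fun y => P t y) (fun y => h t (y - xi)) x); auto.
  - now apply is_derive_h_x.
  - intros; apply Rmult_comm.
Qed.

Lemma pd_t_mult_h (xi : R) (u P : R -> R -> R) (t x dP : R) (ht : 0 < t) :
  (forall s y, 0 < s -> u s y = P s y * h s (y - xi)) ->
  is_derive (fun s => P s x) t dP ->
  pd_t u t x = (dP + (x - xi) ^ 2 / (4 * t ^ 2) * P t x) * h t (x - xi).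
Proof.
  intros Hu HP; unfold pd_t; apply is_derive_unique.
  (* The factorisation of [u] is known at positive times only, so the two functions of [s] are
     compared on the open half-line around [t]. *)
  apply (is_derive_ext_loc (fun s => P s x * h s (x - xi))).
  { apply (filter_imp (fun s => 0 < s)).
    - intros s hs; symmetry; now apply Hu.
    - now apply (open_gt 0). }
  replace (_ * h t (x - xi))
    with (dP * h t (x - xi)
          + P t x * ((x - xi) ^ 2 / (4 * t ^ 2) * h t (x - xi)))
    by (field; lra).
  apply (is_derive_mult (fun s => P s x) (fun s => h s (x - xi)) t); auto.
  - now apply is_derive_h_t.
  - intros; apply Rmult_comm.
Qed.

(** [P] is the rational factor of [u]. The context supplies the factorisation already proved,
    [auto_derive] determines [dP], and [field] checks the announced factor of the derivative. *)
Ltac pd_h lem u P :=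
  intros s y hs;
  etransitivity;
    [ eapply (lem _ u P);
      [ exact hs | eassumption
      | auto_derive; [repeat split; repeat apply Rmult_integral_contrapositive_currified; lra | reflexivity] ]
    | simpl; field; lra ].

Theorem lemma2 (xi t x : R) (ht : 0 < t) :
  let H := fun s y : R => h s (y - xi) in
  (pd_x H t x) ^ 3 / (H t x) ^ 2
    = pd_xxx H t x + 3 / (2 * t) * pd_x H t x
  /\
  (pd_x H t x) ^ 2 * pd_t H t x / (H t x) ^ 2
    = pd_xxt H t x + 2 / t * pd_xx H t x + 1 / (2 * t) * pd_t H t x
      + 1 / (2 * t ^ 2) * H t x
  /\
  (pd_t H t x) ^ 3 / (H t x) ^ 2
    = pd_ttt H t x + 6 / t * pd_tt H t x + 6 / t ^ 2 * pd_t H t x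
  /\
  (pd_t H t x) ^ 2 * pd_x H t x / (H t x) ^ 2
    = pd_xtt H t x + 4 / t * pd_tx H t x + 2 / t ^ 2 * pd_x H t x.
Proof.
  intros H.
  (* The chain of factorisations starts from the factor 1. *)
  assert (E0 : forall s y, 0 < s -> H s y = 1 * h s (y - xi))
    by (intros; unfold H; ring).
  assert (Ex : forall s y, 0 < s ->
    pd_x H s y = - ((y - xi) / (2 * s)) * h s (y - xi)).
  { pd_h pd_x_mult_h H (fun _ _ : R => 1). }
  assert (Et : forall s y, 0 < s ->
    pd_t H s y = (y - xi) ^ 2 / (4 * s ^ 2) * h s (y - xi)).
  { pd_h pd_t_mult_h H (fun _ _ : R => 1). }
  assert (Exx : forall s y, 0 < s ->
    pd_xx H s y
    = ((y - xi) ^ 2 / (4 * s ^ 2) - 1 / (2 * s)) * h s (y - xi)).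
  { pd_h pd_x_mult_h (pd_x H) (fun s y => - ((y - xi) / (2 * s))). }
  (* Intermediate stage for [pd_xtt], which differentiates [pd_x H] twice in time. *)
  assert (Ext : forall s y, 0 < s ->
    pd_t (pd_x H) s y
    = ((y - xi) / (2 * s ^ 2) - (y - xi) ^ 3 / (8 * s ^ 3)) * h s (y - xi)).
  { pd_h pd_t_mult_h (pd_x H) (fun s y => - ((y - xi) / (2 * s))). }
  (* The factor equals that of [Ext] but is derived from [Et], so symmetry of mixed derivatives is
     not invoked. *)
  assert (Etx : forall s y, 0 < s ->
    pd_tx H s y
    = ((y - xi) / (2 * s ^ 2) - (y - xi) ^ 3 / (8 * s ^ 3)) * h s (y - xi)).
  { pd_h pd_x_mult_h (pd_t H) (fun s y => (y - xi) ^ 2 / (4 * s ^ 2)). }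
  assert (Ett : forall s y, 0 < s ->
    pd_tt H s y
    = ((y - xi) ^ 4 / (16 * s ^ 4) - (y - xi) ^ 2 / (2 * s ^ 3))
      * h s (y - xi)).
  { pd_h pd_t_mult_h (pd_t H) (fun s y => (y - xi) ^ 2 / (4 * s ^ 2)). }
  assert (Exxx : forall s y, 0 < s ->
    pd_xxx H s y
    = (3 * (y - xi) / (4 * s ^ 2) - (y - xi) ^ 3 / (8 * s ^ 3))
      * h s (y - xi)).
  { pd_h pd_x_mult_h (pd_xx H)
      (fun s y => (y - xi) ^ 2 / (4 * s ^ 2) - 1 / (2 * s)). }
  assert (Exxt : forall s y, 0 < s ->
    pd_xxt H s y
    = ((y - xi) ^ 4 / (16 * s ^ 4) - 5 * (y - xi) ^ 2 / (8 * s ^ 3)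
       + 1 / (2 * s ^ 2)) * h s (y - xi)).
  { pd_h pd_t_mult_h (pd_xx H)
      (fun s y => (y - xi) ^ 2 / (4 * s ^ 2) - 1 / (2 * s)). }
  assert (Extt : forall s y, 0 < s ->
    pd_xtt H s y
    = (- (y - xi) / s ^ 3 + (y - xi) ^ 3 / (2 * s ^ 4)
       - (y - xi) ^ 5 / (32 * s ^ 5)) * h s (y - xi)).
  { pd_h pd_t_mult_h (pd_t (pd_x H))
      (fun s y => (y - xi) / (2 * s ^ 2) - (y - xi) ^ 3 / (8 * s ^ 3)). }
  assert (Ettt : forall s y, 0 < s ->
    pd_ttt H s y
    = ((y - xi) ^ 6 / (64 * s ^ 6) - 3 * (y - xi) ^ 4 / (8 * s ^ 5)
       + 3 * (y - xi) ^ 2 / (2 * s ^ 4)) * h s (y - xi)).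
  { pd_h pd_t_mult_h (pd_tt H)
      (fun s y => (y - xi) ^ 4 / (16 * s ^ 4) - (y - xi) ^ 2 / (2 * s ^ 3)). }
  rewrite E0, Ex, Et, Exx, Etx, Ett, Exxx, Exxt, Extt, Ettt by exact ht.
  (* Each left side is now a rational function times [h ^ 3 / h ^ 2]; since [h] does not vanish,
     [field] can cancel. *)
  pose proof (h_neq_0 t (x - xi)) as Hh.
  repeat split; field; split; lra.
Qed.
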